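(* Let $n$ be a positive integer. The number $\cos\frac{2\pi}{n}$ is real constructible if and only if $n=2^{\alpha}p_1\cdots p_l$, where $\alpha\ge 0$ and $l\ge 0$ are integers and $p_1,\dots,p_l$ are distinct primes of the form $2^{2^s}+1$ (with $s\ge 0$ an integer depending on the prime).
   Context: A real number $x$ is called real constructible if it can be obtained from the number $1$ by additions, subtractions, multiplications, divisions by nonzero numbers, and extractions of real square roots of nonnegative numbers. That is, there is a finite sequence of real numbers ending with $x$, each term of which is either $1$, or the sum, difference, product or quotient (with nonzero divisor) of two earlier terms, or the square root of an earlier nonnegative term. The empty product ($l=0$) is $1$. *)

(* Defs.v *)
From HB Require Import structures.
From mathcomp Require Import all_boot all_order all_algebra.
From mathcomp Require Import all_classical all_reals all_analysis.
Set Implicit Arguments.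
Unset Strict Implicit.
Unset Printing Implicit Defensive.
Import Order.TTheory GRing.Theory Num.Theory.
Local Open Scope ring_scope.

(* [s] is the list of earlier terms; [y] and [z] may be the same term. *)
Definition constructible_step (R : rcfType) (s : seq R) (x : R) : Prop :=
  x = 1
  \/ (exists y z : R, [/\ y \in s, z \in s &
        [\/ x = y + z, x = y - z, x = y * z | z <> 0 /\ x = y / z]])
  \/ (exists y : R, [/\ y \in s, 0 <= y & x = Num.sqrt y]).

Definition construction (R : rcfType) (s : seq R) : Prop :=
  forall i : nat, (i < size s)%N -> constructible_step (take i s) (nth 0 s i).

Definition real_constructible (R : rcfType) (x : R) : Prop :=
  exists s : seq R, construction (rcons s x).

(* Main.v *)
Require Import Defs.
From mathcomp Require Import all_boot all_order all_algebra.
From mathcomp Require Import all_classical all_reals all_analysis.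
From mathcomp Require Import cyclic all_field complex.
From mathcomp Require Import ring lra zify.
Import Order.TTheory GRing.Theory Num.Theory.
Local Open Scope ring_scope.

(** This is the Gauss-Wantzel theorem.  Put [t = 2 pi / n] and let
    [z = cos t + i sin t], a primitive [n]-th root of unity.

    Necessity is a degree count.  Following a construction step by step, its
    terms all lie in a subfield of the complex numbers of degree [2 ^ m] over
    the rationals, since a square root at most doubles the degree
    ([construction_quadratic_tower]).  Adjoining [i] and
    [sin t = sqrt (1 - cos t ^+ 2)] puts [z] in such a field.  Cyclotomic
    polynomials being irreducible, the degree of [z] is [totient n]
    ([totient_dvd_dim]), so [totient n] divides [2 ^ m].  Arithmetic does the
    rest ([totient_dvd_expn2]): an odd prime divides [n] at most once, it is
    [2 ^ k + 1], and then [k] has no odd factor other than 1.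

    Sufficiency avoids Galois theory.  The complex numbers with constructible
    real and imaginary parts form a field [P] closed under square roots.  Let
    [p = 2 ^ m + 1] be prime.  For a multiplicative character [chi] of the field
    with [p] elements, the square of its Gauss sum equals
    [A + J * gauss_sum (chi ^+ 2)], where [A] and [J] are polynomials in values
    of [chi] ([gauss_sum_sqr]).  These values are [2 ^ m]-th roots of unity, so
    they are in [P], and squaring [m] times makes [chi] trivial.  Hence every
    Gauss sum is in [P] ([qclosed_gauss_sum]).  A [p]-th root of unity is
    an average of Gauss sums ([gauss_sum_inversion]), so it is in [P].
    Distinct primes are combined with Bezout, and powers of 2 with square
    roots ([qclosed_fermat_unity_roots]). *)

(** * Numbers whose totient is a power of 2 *)

Section FermatPrimes.
Local Open Scope nat_scope.

(** [x] is congruent to [-1] modulo [x.+1]. *)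
Lemma dvdn_succ_expn_odd (x q : nat) : odd q -> x.+1 %| (x ^ q).+1.
Proof.
move=> q_odd; rewrite -[q]odd_double_half q_odd add1n.
elim: q./2 => [|j IHj]; first by rewrite expn1.
have [->|x_gt0] := posnP x; first exact: dvd1n.
have -> : (x ^ j.+1.*2.+1).+1 = x ^ 2 * (x ^ j.*2.+1).+1 - x.-1 * x.+1.
  rewrite doubleS -addn3 -[j.*2.+1]addn1 !expnD -[x in _.-1 * x.+1](prednK x_gt0).
  case: x x_gt0 IHj => // x _ _ /=; set y := _ ^ j.*2.
  by have : 0 < y; [rewrite expn_gt0 | nia].
by rewrite dvdn_sub ?dvdn_mull.
Qed.

(** If [k = 2 ^ s * q] with [q] odd, then [2 ^ (2 ^ s) + 1] divides [2 ^ k + 1],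
    so primality forces [q = 1]. *)
Lemma prime_succ_expn2 (k : nat) :
  0 < k -> prime (2 ^ k).+1 -> exists s, k = 2 ^ s.
Proof.
move=> k_gt0 k_prime; have [q q_odd Dk] := pfactor_coprime (erefl : prime 2) k_gt0.
exists (logn 2 k); set s := 2 ^ _ in Dk *.
rewrite coprime2n in q_odd; rewrite Dk mulnC expnM in k_prime.
have := dvdn_succ_expn_odd (2 ^ s) q q_odd.
move/(primeP k_prime).2/orP => [] /eqP.
  by case=> /eqP; rewrite expn_eq0.
case=> /eqP; rewrite -expnM eqn_exp2l // => /eqP Es.
by rewrite Dk [s in RHS]Es mulnC.
Qed.

Lemma prime_pred_dvd_expn2 (p m : nat) :
  prime p -> odd p -> p.-1 %| 2 ^ m -> exists s, p = 2 ^ (2 ^ s) + 1.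
Proof.
move=> p_prime p_odd /(dvdn_pfactor _ _ (erefl : prime 2)) [k _ Dk].
have Dp : p = (2 ^ k).+1 by rewrite -Dk prednK ?prime_gt0.
have k_gt0 : 0 < k.
  by case: k Dp {Dk} => // Dp; rewrite Dp in p_odd.
rewrite Dp in p_prime.
by have [s Ds] := prime_succ_expn2 k k_gt0 p_prime; exists s; rewrite -Ds addn1.
Qed.

(** If [p ^ e] exactly divides [n], then [p ^ e.-1 * p.-1] divides
    [totient n]; for odd [p] this leaves only [e = 1]. *)
Lemma totient_dvd_expn2 (n m : nat) : 0 < n -> totient n %| 2 ^ m ->
  exists (a : nat) (ps : seq nat),
    [/\ uniq ps,
        (forall p : nat, p \in ps ->
           prime p /\ exists s : nat, p = (2 ^ (2 ^ s) + 1)%N) &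
        n = (2 ^ a * \prod_(p <- ps) p)%N].
Proof.
move=> n_gt0 tot_n; have [q q_odd Dn] := pfactor_coprime (erefl : prime 2) n_gt0.
have q_gt0 : 0 < q by move: n_gt0; rewrite Dn muln_gt0 => /andP[].
have tot_q : totient q %| 2 ^ m.
  apply: dvdn_trans tot_n; rewrite (congr1 totient Dn) totient_coprime ?dvdn_mulr //.
  by rewrite coprime_sym coprimeXl.
have primes_odd p : p \in primes q -> odd p.
  rewrite mem_primes => /and3P[p_prime _ p_dvd].
  by rewrite coprime2n in q_odd; apply: dvdn_odd p_dvd q_odd.
have tot_p p : p \in primes q -> logn p q = 1 /\ p.-1 %| 2 ^ m.
  move=> p_q; have := p_q; rewrite mem_primes => /and3P[p_prime _ p_dvd].
  have e_gt0 : 0 < logn p q by rewrite logn_gt0.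
  have [r r_co Dq] := pfactor_coprime p_prime q_gt0.
  have : totient (p ^ logn p q) %| 2 ^ m.
    apply: dvdn_trans tot_q; rewrite (congr1 totient Dq) totient_coprime ?dvdn_mull //.
    by rewrite coprime_sym coprimeXl.
  rewrite totient_pfactor // => dvd2m; split; last first.
    exact: dvdn_trans (dvdn_mulr _ (dvdnn _)) dvd2m.
  have := dvdn_trans (dvdn_mull _ (dvdnn _)) dvd2m.
  case: (logn p q) e_gt0 => // [[//|e]] _ /= /(dvdn_trans (dvdn_exp (isT : 0 < e.+1) (dvdnn p))).
  rewrite Euclid_dvdX // dvdn_prime2 // => /andP[/eqP Dp _].
  by have := primes_odd p p_q; rewrite Dp.
exists (logn 2 n), (primes q); split.
- exact: primes_uniq.
- move=> p p_q; have := p_q; rewrite mem_primes => /and3P[p_prime _ _]; split=> //.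
  by apply: prime_pred_dvd_expn2 (primes_odd p p_q) (tot_p p p_q).2.
- rewrite {1}Dn mulnC; congr (_ * _).
  rewrite {1}(prod_prime_decomp q_gt0) prime_decompE big_map /=.
  by apply: eq_big_seq => p /tot_p[-> _]; rewrite expn1.
Qed.

End FermatPrimes.

(** * Roots of unity in a quadratically closed field *)

(* [P] is a subfield of [F] that contains the square roots in [F] of its
   elements. *)
Section QuadraticallyClosed.

Variables (F : fieldType) (P : F -> Prop).
Hypotheses (P1 : P 1) (PB : forall x y, P x -> P y -> P (x - y)).
Hypotheses (PM : forall x y, P x -> P y -> P (x * y)) (PV : forall x, P x -> P x^-1).
Hypothesis Psqrt : forall x, P (x ^+ 2) -> P x.

Lemma qclosed0 : P 0. Proof. by rewrite -(subrr 1); apply: PB. Qed.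
Lemma qclosedD x y : P x -> P y -> P (x + y).
Proof.
by move=> Px Py; rewrite -[y]opprK -[- y]sub0r; do !apply: PB => //; apply: qclosed0.
Qed.
Lemma qclosedX x n : P x -> P (x ^+ n).
Proof. by move=> Px; elim: n => [|n IHn]; rewrite ?expr0 ?exprS //; apply: PM. Qed.
Lemma qclosed_sum (I : finType) (A : pred I) (G : I -> F) :
  (forall i, A i -> P (G i)) -> P (\sum_(i | A i) G i).
Proof. by move=> PG; elim/big_rec: _ => [|i x /PG]; [exact: qclosed0 | exact: qclosedD]. Qed.
Lemma qclosed_nat n : P n%:R.
Proof. by elim: n => [|n IHn]; [exact: qclosed0 | rewrite -natr1; apply: qclosedD]. Qed.

Lemma qclosed_root2X m x : P (x ^+ (2 ^ m)%N) -> P x.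
Proof.
elim: m x => [|m IHm] x; first by rewrite expn0 expr1.
by rewrite expnS exprM => /IHm/Psqrt.
Qed.

Section GaussSum.

Variables (K : finFieldType) (e : K -> F).
(* [e] is a nontrivial additive character, normalised to be nontrivial at 1. *)
Hypotheses (e0 : e 0 = 1) (eD : forall x y, e (x + y) = e x * e y) (e1 : e 1 != 1).

Definition multiplicative_char (chi : K -> F) :=
  forall x y, x != 0 -> y != 0 -> chi (x * y) = chi x * chi y.

Definition gauss_sum (chi : K -> F) := \sum_(x | x != 0) chi x * e x.

Lemma additive_char_sum : \sum_x e x = 0.
Proof.
have : e 1 * \sum_x e x = \sum_x e x.
  rewrite [RHS](reindex_inj (addrI 1)) big_distrr /=.
  by apply: eq_bigr => x _; rewrite eD.
move/eqP; rewrite -subr_eq0 -[X in _ - X]mul1r -mulrBl mulf_eq0 subr_eq0.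
by rewrite (negPf e1) => /eqP.
Qed.

(** In the double sum over [x] and [y] substitute [y = x * t]; the inner sum
    over [x] then runs against the character [x |-> e (x * (1 + t))].  That
    character is trivial for [t = -1], and a rescaling of [e] otherwise. *)
Lemma gauss_sum_sqr chi : multiplicative_char chi ->
  gauss_sum chi ^+ 2 =
    \sum_(t | t != 0) chi t *
      (if 1 + t == 0 then \sum_(x | x != 0) chi x ^+ 2
       else chi (1 + t)^-1 ^+ 2 * gauss_sum (fun x => chi x ^+ 2)).
Proof.
move=> chiM; rewrite expr2 {1}/gauss_sum big_distrl /=.
transitivity (\sum_(x | x != 0) \sum_(t | t != 0)
                 chi t * (chi x ^+ 2 * e (x * (1 + t)))).
  apply: eq_bigr => x x_neq0.
  rewrite /gauss_sum (reindex_onto (fun t => x * t) (fun y => x^-1 * y)) /=; last first.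
    by move=> y _; rewrite mulrA divff // mul1r.
  rewrite big_distrr /=; apply: eq_big => [t|t].
    by rewrite mulf_eq0 negb_or x_neq0 mulKf ?eqxx ?andbT.
  rewrite mulf_eq0 negb_or => /andP[/andP[_ t_neq0] _].
  by rewrite chiM // mulrDr mulr1 eD expr2; ring.
rewrite exchange_big; apply: eq_bigr => t t_neq0 /=.
rewrite -big_distrr /=; congr (_ * _); case: ifPn => [/eqP->|u_neq0].
  apply: eq_bigr => x _; rewrite mulr0.
  by rewrite e0 mulr1.
rewrite /gauss_sum big_distrr /=.
rewrite (reindex_onto (fun y => y * (1 + t)^-1) (fun x => x * (1 + t))) /=; last first.
  by move=> x _; rewrite mulfK.
apply: eq_big => [y|y].
  by rewrite mulf_eq0 invr_eq0 negb_or u_neq0 mulfVK ?eqxx ?andbT.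
rewrite mulf_eq0 negb_or => /andP[/andP[y_neq0 _] _].
by rewrite mulfVK // chiM ?invr_eq0 // exprMn; ring.
Qed.

(** Induction on the exponent [m]: the values of [chi ^+ 2] are
    [2 ^ m]-th roots of unity when those of [chi] are [2 ^ m.+1]-th ones, and a
    trivial character has Gauss sum [-1]. *)
Lemma qclosed_gauss_sum m chi : multiplicative_char chi ->
  (forall x, x != 0 -> chi x ^+ (2 ^ m)%N = 1) -> P (gauss_sum chi).
Proof.
elim: m chi => [|m IHm] chi chiM chi1.
  rewrite (_ : gauss_sum chi = 0 - 1); first exact: PB qclosed0 P1.
  rewrite -additive_char_sum (bigD1 0) //= e0 [1 + _]addrC addrK.
  by apply: eq_bigr => x /chi1; rewrite expn0 expr1 => ->; rewrite mul1r.
have Pchi x : x != 0 -> P (chi x).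
  by move=> /chi1 chi_x; apply: (@qclosed_root2X m.+1); rewrite chi_x.
apply: Psqrt; rewrite gauss_sum_sqr //; apply: qclosed_sum => t t_neq0.
apply: PM (Pchi t t_neq0) _; case: ifPn => [_|u_neq0].
  by apply: qclosed_sum => x x_neq0; apply: qclosedX; apply: Pchi.
apply: PM; first by apply: qclosedX; apply: Pchi; rewrite invr_eq0.
apply: IHm => [x y x_neq0 y_neq0|x x_neq0]; first by rewrite chiM // exprMn.
by rewrite -exprM -expnS chi1.
Qed.

(** Orthogonality: for [x != 1] the number [chi x] is an [n]-th root of unity
    other than 1, so its powers sum to zero, and only [x = 1] survives. *)
Lemma gauss_sum_inversion (chi : K -> F) (n : nat) :
  (forall x, x != 0 -> chi x ^+ n = 1) ->
  (forall x, x != 0 -> chi x = 1 -> x = 1) -> chi 1 = 1 ->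
  \sum_(i < n) gauss_sum (fun x => chi x ^+ i) = n%:R * e 1.
Proof.
move=> chin chi_inj chi_1; rewrite exchange_big (bigD1 1) ?oner_neq0 //=.
rewrite [X in _ + X]big1 ?addr0 => [|x /andP[x_neq0 x_neq1]].
  rewrite -big_distrl /= chi_1; congr (_ * _).
  by under eq_bigr do rewrite expr1n; rewrite sumr_const card_ord.
rewrite -big_distrl /=; apply/eqP; rewrite mulf_eq0; apply/orP; left.
have : (chi x - 1) * \sum_(i < n) chi x ^+ i == 0.
  by rewrite -subrX1 chin // subrr.
rewrite mulf_eq0 subr_eq0 => /orP[/eqP chi_x|//].
by rewrite (chi_inj x) ?eqxx in x_neq1.
Qed.

(** The units of [K] are the powers of a generator [g], and [g ^+ i |-> w ^+ i]
    is well defined and injective as [g] and [w] have the same order. *)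
Lemma faithful_char_exists (w : F) : (#|K|.-1).-primitive_root w ->
  exists chi : K -> F,
    [/\ multiplicative_char chi, forall x, x != 0 -> chi x ^+ #|K|.-1 = 1,
        forall x, x != 0 -> chi x = 1 -> x = 1 & chi 1 = 1].
Proof.
move=> prim_w; set n := #|K|.-1 in prim_w *.
have unity (x : K) : x != 0 -> x ^+ n = 1.
  move=> x_neq0; apply: (mulIf x_neq0); rewrite mul1r -exprSr prednK ?expf_card //.
  by apply/card_gt0P; exists 0.
have [g prim_g] : exists g : K, n.-primitive_root g.
  have /hasP[g _ ?] : has n.-primitive_root (enum (predC1 (0 : K))).
    apply: has_prim_root (prim_order_gt0 prim_w) _ (enum_uniq _) _.
      by apply/allP => x; rewrite mem_enum unity_rootE => /unity->.
    by rewrite -cardE cardC1.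
  by exists g.
have log_subproof x : {i : 'I_n | x != 0 -> x = g ^+ i}.
  have [->|x_neq0] := eqVneq x 0; first by exists (Ordinal (prim_order_gt0 prim_w)).
  by have [i ->] := prim_rootP prim_g (unity x x_neq0); exists i.
pose log x : nat := sval (log_subproof x).
have logK x : x != 0 -> g ^+ log x = x.
  by rewrite /log; case: (log_subproof x) => i /= Dx /Dx.
have chi_eq i j : g ^+ i = g ^+ j -> w ^+ i = w ^+ j.
  by move=> /eqP; rewrite (eq_prim_root_expr prim_g) -(eq_prim_root_expr prim_w) => /eqP.
exists (fun x => w ^+ log x); split.
- move=> x y x_neq0 y_neq0; rewrite -exprD; apply: chi_eq.
  by rewrite exprD !logK // mulf_neq0.
- by move=> x _; rewrite exprAC (prim_expr_order prim_w) expr1n.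
- move=> x x_neq0 /eqP; rewrite -[1](expr0 w) (eq_prim_root_expr prim_w).
  by rewrite -(eq_prim_root_expr prim_g) logK // expr0 => /eqP.
- by rewrite -[RHS](expr0 w); apply: chi_eq; rewrite logK ?oner_neq0.
Qed.

(** The Gauss sums of the powers of a faithful character average to [e 1]. *)
Lemma qclosed_additive_char (w : F) (m : nat) :
  (#|K|.-1).-primitive_root w -> #|K|.-1 = (2 ^ m)%N -> (2%:R : F) != 0 -> P (e 1).
Proof.
move=> prim_w card_K two_neq0.
have [chi [chiM chin chi_inj chi_1]] := faithful_char_exists w prim_w.
have -> : e 1 = (#|K|.-1)%:R^-1 * \sum_(i < #|K|.-1) gauss_sum (fun x => chi x ^+ i).
  rewrite (gauss_sum_inversion chi) // mulKf //.
  by rewrite card_K natrX expf_neq0.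
apply: PM; first by apply/PV/qclosed_nat.
apply: qclosed_sum => i _; apply: (@qclosed_gauss_sum m) => [x y x_neq0 y_neq0|x x_neq0].
  by rewrite chiM // exprMn.
by rewrite -card_K exprAC chin // expr1n.
Qed.

End GaussSum.

(** With [1 + a * n = c * m], a [(m * n)]-th root of unity [z] is the quotient of
    [z ^+ (c * m)], an [n]-th root of unity, by [z ^+ (n * a)], an [m]-th one. *)
Lemma qclosed_unity_roots_coprime (m n : nat) :
  (0 < m)%N -> coprime m n ->
  (forall z, z ^+ m = 1 -> P z) -> (forall z, z ^+ n = 1 -> P z) ->
  forall z, z ^+ (m * n)%N = 1 -> P z.
Proof.
move=> m_gt0 co_mn Pm Pn z z1; have [a _] := Bezoutl n m_gt0.
rewrite (eqP co_mn) => /dvdnP[c Dc].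
have Pzn : P ((z ^+ n) ^+ a) by apply/qclosedX/Pm; rewrite -exprM mulnC.
have Pzm : P (z ^+ (1 + a * n)).
  rewrite Dc; apply: Pn; rewrite -exprM [(c * m)%N]mulnC mulnAC exprM z1 expr1n //.
have zn_neq0 : z ^+ n ^+ a != 0.
  apply/eqP => zn0; move/eqP: z1; rewrite mulnC exprM.
  move/eqP: zn0; rewrite expf_eq0 => /andP[_ /eqP->].
  by rewrite expr0n eqn0Ngt m_gt0 /= eq_sym oner_eq0.
rewrite -(mulfK zn_neq0 z); apply: PM (PV _ Pzn).
by move: Pzm; rewrite exprD expr1 mulnC exprM.
Qed.

Lemma qclosed_fermat_unity_roots (a : nat) (ps : seq nat) :
  (2%:R : F) != 0 ->
  (forall m, exists w : F, (2 ^ m)%N.-primitive_root w) ->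
  uniq ps ->
  (forall p, p \in ps -> prime p /\ exists m, p = (2 ^ m + 1)%N) ->
  forall z, z ^+ (2 ^ a * \prod_(p <- ps) p)%N = 1 -> P z.
Proof.
move=> two_neq0 prim_root uniq_ps ps_fermat z.
rewrite mulnC exprM -exprM mulnC exprM => z1; apply: (@qclosed_root2X a).
move: (z ^+ _) z1 => {}z.
elim: ps uniq_ps ps_fermat z => [_ _ z|p ps IHps /andP[p_notin uniq_ps] ps_fermat z].
  by rewrite big_nil expr1 => ->.
have [p_prime [m Dp]] := ps_fermat p (mem_head p ps).
rewrite big_cons; apply: qclosed_unity_roots_coprime; first exact: prime_gt0.
- rewrite coprime_sym big_seq; elim/big_rec: _ => [|q r q_in co_r].
    by rewrite /coprime gcd1n.
  rewrite coprimeMl co_r andbT prime_coprime ?dvdn_prime2 //.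
  + by apply: contraNneq p_notin => <-.
  + by have [] := ps_fermat q; rewrite // inE q_in orbT.
  + by have [] := ps_fermat q; rewrite // inE q_in orbT.
- move=> {}z zp; have [->|z_neq1] := eqVneq z 1; first exact: P1.
  have [w prim_w] := prim_root m.
  have card_K : #|'F_p|.-1 = (2 ^ m)%N by rewrite card_Fp // Dp addn1.
  (* The character sending 1 to [z], to which the Gauss sums apply. *)
  pose e (x : 'F_p) : F := z ^+ x.
  have eD x y : e (x + y) = e x * e y by rewrite -exprD /e expr_mod // Fp_cast.
  have e1 : e 1 = z by rewrite /e expr_mod ?Fp_cast // expr1.
  rewrite -e1; apply: (@qclosed_additive_char _ e _ eD _ w m) => //.
  + by rewrite card_K.
- by apply: IHps => // q q_in; apply: ps_fermat; rewrite inE q_in orbT.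
Qed.

End QuadraticallyClosed.

(** * Degrees of roots of unity and quadratic towers *)

(** [z] is a root of ['X^n - 1], the product of the [Cyclotomic d] for [d]
    dividing [n]; being a root of [Cyclotomic d] implies [z ^+ d = 1], hence
    [d = n]. *)
Lemma root_Cyclotomic_prim (F : fieldType) (n : nat) (z : F) :
  n.-primitive_root z -> root (map_poly intr (Cyclotomic n)) z.
Proof.
move=> prim_z; have n_gt0 := prim_order_gt0 prim_z.
have : root (map_poly intr (\prod_(d <- divisors n) Cyclotomic d)) z.
  rewrite prod_Cyclotomic // rmorphB rmorph1 /= map_polyXn.
  by rewrite rootE !hornerE prim_expr_order // subrr.
rewrite rmorph_prod /= rootE horner_prod prodf_seq_eq0 => /hasP[d d_div /= d0].
have d_dvd : (d %| n)%N by rewrite dvdn_divisors.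
suff -> : n = d by [].
have d_gt0 := dvdn_gt0 n_gt0 d_dvd.
apply/eqP; rewrite eqn_dvd d_dvd andbT (prim_order_dvd prim_z) -subr_eq0.
have : root (map_poly intr (\prod_(d' <- divisors d) Cyclotomic d')) z.
  rewrite rmorph_prod /= rootE horner_prod prodf_seq_eq0; apply/hasP; exists d => //.
  by rewrite -dvdn_divisors.
by rewrite prod_Cyclotomic // rmorphB rmorph1 /= map_polyXn rootE !hornerE.
Qed.

(** A form of irreducibility over the rationals, for use outside [algC]: a
    complex root of [q] is a primitive [n]-th root of unity, and its minimal
    polynomial is [Cyclotomic n]. *)
Lemma Cyclotomic_minimal (n : nat) (q : {poly rat}) :
  (1 < size q)%N -> q %| map_poly intr (Cyclotomic n) ->
  (totient n < size q)%N.
Proof.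
move=> q_gt1 q_dvd.
have [y qy] : exists y : algC, root (map_poly ratr q) y.
  by apply/closed_rootP; rewrite size_map_poly neq_ltn q_gt1 orbT.
have q_neq0 : q != 0 by rewrite -size_poly_gt0 ltnW.
have Phi_y : root (map_poly intr (Cyclotomic n)) y.
  have := q_dvd; rewrite -(dvdp_map (ratr : {rmorphism rat -> algC})) /= => /root_dvdp/(_ qy).
  by rewrite -map_poly_comp (eq_map_poly (fun x => ratr_int _ x)).
have prim_y : n.-primitive_root y.
  have [n_eq0|n_gt0] := posnP n.
    by move: Phi_y; rewrite n_eq0 Cyclotomic0 rmorph1 rootE hornerC oner_eq0.
  have [w prim_w] := C_prim_root_exists n_gt0.
  by move: Phi_y; rewrite (Cintr_Cyclotomic prim_w) (root_cyclotomic prim_w).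
have [p [Dp _] dvd_p] := minCpolyP y.
have p_dvd : p %| q by rewrite -dvd_p.
rewrite -(size_cyclotomic y) -(minCpoly_cyclotomic prim_y) Dp size_map_poly.
exact: dvdp_leq.
Qed.

Lemma totient_dvd_dim (K : fieldExtType rat) (n : nat) (z : K) :
  n.-primitive_root z -> (totient n %| \dim {:K})%N.
Proof.
move=> prim_z; have := field_dimS (subvf <<1; z>>%AS).
rewrite dim_Fadjoin dimv1 muln1; set d := adjoin_degree _ _.
suff -> : d = totient n by [].
have /polyOver1P[q Dq] := minPolyOver 1%AS z.
have size_q : size q = d.+1 by rewrite -size_minPoly Dq size_map_poly.
have q_dvd : q %| map_poly intr (Cyclotomic n).
  rewrite -(dvdp_map (in_alg K)) /= -Dq; apply: minPoly_dvdp.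
    by apply/polyOver1P; eexists.
  rewrite -map_poly_comp (eq_map_poly (fun x => rmorph_int _ x)).
  exact: root_Cyclotomic_prim.
have d_gt0 : (0 < d)%N by [].
apply/eqP; rewrite eqn_leq -ltnS -[in X in _ && X]ltnS -size_q Cyclotomic_minimal ?size_q // andbT.
rewrite -[totient n]/(totient n).+1.-1 -(size_Cyclotomic n) -size_q.
rewrite -(size_map_inj_poly (@intr_inj rat)) // dvdp_leq //.
by rewrite monic_neq0 ?monic_map ?Cyclotomic_monic.
Qed.


(** An embedded number field stands for the top of a tower of quadratic
    extensions; of the tower only its degree [2 ^ m] is retained. *)
Definition in_quadratic_tower (C : fieldType) (s : seq C) : Prop :=
  exists (K : fieldExtType rat) (iota : {rmorphism K -> C}) (m : nat),
    \dim {:K} = (2 ^ m)%N /\ forall x, x \in s -> exists a, iota a = x.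

Section QuadraticTower.
Variable C : numFieldType.

Lemma quadratic_tower_nil : in_quadratic_tower C [::].
Proof.
exists (rat^o : fieldExtType rat), (ratr : {rmorphism rat -> C}), 0%N.
by rewrite dimvf.
Qed.

(** If [w] is not already in the image of [K], then ['X^2 - a] has no root in
    [K], so it is irreducible and [K(w)] has degree 2 over [K]. *)
Lemma quadratic_step (K : fieldExtType rat) (iota : {rmorphism K -> C}) (a : K) (w : C) :
  w ^+ 2 = iota a ->
  exists (L : fieldExtType rat) (kappa : {rmorphism L -> C}),
  [/\ \dim {:L} = \dim {:K} \/ \dim {:L} = (2 * \dim {:K})%N,
      forall b, exists c, kappa c = iota b & exists c, kappa c = w].
Proof.
move=> Dw; have [[b Db]|w_notin] := pselect (exists b, iota b = w).
  by exists K, iota; split; [left | move=> c; exists c | exists b].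
pose p : {poly K} := 'X^2 - a%:P.
have size_p : size p = 3 by rewrite size_XnsubC.
have pw : root (map_poly iota p) w.
  by rewrite rmorphB /= map_polyXn map_polyC rootE !hornerE Dw subrr.
have irr_p : irreducible_poly p.
  apply: cubic_irreducible => [|b]; first by rewrite size_p.
  apply/negP; rewrite rootE !hornerE subr_eq0 => /eqP Db.
  have /eqP : w ^+ 2 = iota b ^+ 2 by rewrite Dw -Db rmorphXn.
  rewrite eqf_sqr => /orP[] /eqP Ew; apply: w_notin; first by exists b.
  by exists (- b); rewrite rmorphN.
have p_neq0 : p != 0 by rewrite -size_poly_eq0 size_p.
pose L := SubFieldExtType pw irr_p.
exists (baseFieldType L), (@subfx_inj _ _ iota w p : {rmorphism L -> C}); split.
- right; have <- : baseVspace {:L} = fullv :> {vspace baseFieldType L}.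
    apply/vspaceP => b; rewrite [RHS]memvf; have := mem_baseVspace {:L} b.
    by rewrite [X in _ = X -> _]memvf.
  have dim_L : \dim {:L} = 2 by rewrite dimvf; change ((size p).-1 = 2); rewrite size_p.
  by rewrite dim_baseVspace dim_L.
- by move=> b; exists (inj_subfx iota w p b); have := subfx_inj_eval pw p_neq0 b%:P; rewrite map_polyC hornerC.
- by exists (subfx_root iota w p); exact: (subfx_inj_root pw p_neq0).
Qed.

(** The hypothesis on [x] ranges over all embedded fields containing [s], because
    the one provided by the tower is not known in advance. *)
Lemma quadratic_tower_rcons (s : seq C) (x : C) :
  (forall (K : fieldExtType rat) (iota : {rmorphism K -> C}),
     (forall y, y \in s -> exists a, iota a = y) -> exists a, iota a = x ^+ 2) ->
  in_quadratic_tower C s -> in_quadratic_tower C (rcons s x).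
Proof.
move=> sqr_x [K [iota [m [dim_K Ks]]]].
have [a Da] := sqr_x K iota Ks.
have [L [kappa [dim_L kappaK [c Dc]]]] := quadratic_step K iota a x (esym Da).
exists L, kappa; have [Em|Em] := dim_L; [exists m | exists m.+1].
all: rewrite Em ?expnS dim_K; split=> // y; rewrite mem_rcons inE.
all: case/predU1P=> [->|/Ks[b <-]]; [by exists c | exact: kappaK].
Qed.

End QuadraticTower.

(** * Constructible real and complex numbers *)

Section RealConstructible.
Variable R : rcfType.
Implicit Types (s t : seq R) (x y z : R).

Lemma constructible_step_sub s t x : {subset s <= t} ->
  constructible_step s x -> constructible_step t x.
Proof.
move=> s_t [x1|[[y [z [ys zs Dx]]]|[y [ys y_ge0 Dx]]]].
- by left.
- by right; left; exists y, z; split=> //; apply: s_t.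
- by right; right; exists y; split=> //; apply: s_t.
Qed.

Lemma construction_rcons s x :
  construction (rcons s x) <-> construction s /\ constructible_step s x.
Proof.
split=> [c_sx|[c_s x_s] i]; last first.
  rewrite size_rcons ltnS leq_eqVlt => /predU1P[->|i_lt].
    by rewrite nth_rcons ltnn eqxx -cats1 takel_cat // take_size.
  by rewrite nth_rcons i_lt -cats1 takel_cat ?(ltnW i_lt) //; apply: c_s.
split=> [i i_lt|].
  have := c_sx i; rewrite size_rcons ltnS ltnW // => /(_ isT).
  by rewrite nth_rcons i_lt -cats1 takel_cat ?(ltnW i_lt).
have := c_sx (size s); rewrite size_rcons ltnS leqnn => /(_ isT).
by rewrite nth_rcons ltnn eqxx -cats1 takel_cat // take_size.
Qed.

Lemma construction_cat s t : construction s -> construction t -> construction (s ++ t).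
Proof.
move=> c_s; elim/last_ind: t => [|t x IHt]; first by rewrite cats0.
move=> /construction_rcons[/IHt c_st x_t]; rewrite -rcons_cat.
apply/construction_rcons; split=> //; apply: constructible_step_sub x_t.
by move=> y; rewrite mem_cat orbC => ->.
Qed.

(** Any prefix of a construction is a construction, so its terms need not come
    last. *)
Lemma real_constructibleP x :
  real_constructible x <-> exists2 s, construction s & x \in s.
Proof.
split=> [[s c_sx]|[s]]; first by exists (rcons s x); rewrite ?mem_rcons ?mem_head.
elim/last_ind: s => // s y IHs /[dup] c_sy /construction_rcons[c_s _].
by rewrite mem_rcons inE => /predU1P[->|/(IHs c_s)//]; exists s.
Qed.

(** Two constructions can be concatenated, so that both operands are available
    for one more step. *)
Lemma real_constructible_step2 x y z : real_constructible x -> real_constructible y ->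
  (forall s, x \in s -> y \in s -> constructible_step s z) -> real_constructible z.
Proof.
move=> /real_constructibleP[s c_s xs] /real_constructibleP[t c_t yt] step_z.
exists (s ++ t); apply/construction_rcons; split; first exact: construction_cat.
by apply: step_z; rewrite mem_cat ?xs ?yt ?orbT.
Qed.

Lemma real_constructible1 : real_constructible (1 : R).
Proof. by exists [::]; apply/construction_rcons; split=> //; left. Qed.

Lemma real_constructibleD x y :
  real_constructible x -> real_constructible y -> real_constructible (x + y).
Proof.
move=> cx cy; apply: real_constructible_step2 cx cy _ => s xs ys.
by right; left; exists x, y; split=> //; constructor 1.
Qed.

Lemma real_constructibleB x y :
  real_constructible x -> real_constructible y -> real_constructible (x - y).
Proof.
move=> cx cy; apply: real_constructible_step2 cx cy _ => s xs ys.
by right; left; exists x, y; split=> //; constructor 2.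
Qed.

Lemma real_constructibleM x y :
  real_constructible x -> real_constructible y -> real_constructible (x * y).
Proof.
move=> cx cy; apply: real_constructible_step2 cx cy _ => s xs ys.
by right; left; exists x, y; split=> //; constructor 3.
Qed.

Lemma real_constructible0 : real_constructible (0 : R).
Proof. by rewrite -(subrr 1); apply: real_constructibleB real_constructible1 real_constructible1. Qed.

Lemma real_constructibleN x : real_constructible x -> real_constructible (- x).
Proof. by rewrite -sub0r; apply/real_constructibleB/real_constructible0. Qed.

Lemma real_constructibleV x : real_constructible x -> real_constructible x^-1.
Proof.
have [->|x_neq0 cx] := eqVneq x 0; first by rewrite invr0.
apply: real_constructible_step2 real_constructible1 cx _ => s s1 xs.
by right; left; exists 1, x; split=> //; constructor 4; rewrite div1r; split=> //; apply/eqP.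
Qed.

Lemma real_constructible_sqrt x : real_constructible x -> real_constructible (Num.sqrt x).
Proof.
move=> cx; have [/ltW/ler0_sqrtr->|x_ge0] := ltP x 0; first exact: real_constructible0.
apply: (real_constructible_step2 x x) => // s xs _.
by right; right; exists x.
Qed.

Definition complex_constructible (z : R[i]) :=
  real_constructible (complex.Re z) /\ real_constructible (complex.Im z).

Lemma complex_constructible1 : complex_constructible 1.
Proof. by split; [exact: real_constructible1 | exact: real_constructible0]. Qed.

Lemma complex_constructibleB (z w : R[i]) :
  complex_constructible z -> complex_constructible w -> complex_constructible (z - w).
Proof. by case: z w => [a b] [c d] [/= ca cb] [/= cc cd]; split; apply: real_constructibleB. Qed.

Lemma complex_constructibleM (z w : R[i]) :
  complex_constructible z -> complex_constructible w -> complex_constructible (z * w).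
Proof.
case: z w => [a b] [c d] [/= ca cb] [/= cc cd]; split.
  by apply: real_constructibleB; apply: real_constructibleM.
by apply: real_constructibleD; apply: real_constructibleM.
Qed.

Lemma complex_constructibleV (z : R[i]) :
  complex_constructible z -> complex_constructible z^-1.
Proof.
case: z => [a b] [/= ca cb].
have cn : real_constructible (a ^+ 2 + b ^+ 2)^-1.
  by rewrite !expr2; apply/real_constructibleV/real_constructibleD; apply: real_constructibleM.
by split; [|apply: real_constructibleN]; apply: real_constructibleM.
Qed.

(** A square root of [a + b i] has real and imaginary parts
    [sqrt ((r + a) / 2)] and [sqrt ((r - a) / 2)] up to sign, where
    [r = sqrt (a ^+ 2 + b ^+ 2)]. *)
Lemma complex_constructible_root2 (z : R[i]) :
  complex_constructible (z ^+ 2) -> complex_constructible z.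
Proof.
move=> cz2; suff csqrt : complex_constructible (sqrtc (z ^+ 2)).
  have /eqP := sqr_sqrtc (z ^+ 2); rewrite eqf_sqr => /orP[] /eqP Dz; rewrite Dz // in csqrt.
  by move: csqrt; case: z {cz2 Dz} => [a b] [/real_constructibleN + /real_constructibleN]; rewrite /= !opprK.
case: (z ^+ 2) cz2 => {z} [a b] [/= ca cb].
have c2 : real_constructible (2^-1 : R).
  apply: real_constructibleV; rewrite (_ : 2 = 1 + 1) //.
  by apply: real_constructibleD; exact: real_constructible1.
have cr : real_constructible (Num.sqrt (a ^+ 2 + b ^+ 2)).
  by apply: real_constructible_sqrt; rewrite !expr2; apply: real_constructibleD;
    apply: real_constructibleM.
split.
  by apply/real_constructible_sqrt/real_constructibleM => //; apply: real_constructibleD.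
apply: real_constructibleM; last first.
  by apply/real_constructible_sqrt/real_constructibleM => //; apply: real_constructibleB.
case: ifP => _; first exact: real_constructible1.
case: sgrP => _; [exact: real_constructible0 | exact: real_constructible1 |].
by apply: real_constructibleN; exact: real_constructible1.
Qed.

Lemma construction_quadratic_tower s : construction s ->
  in_quadratic_tower R[i] [seq x%:C%C | x <- s].
Proof.
elim/last_ind: s => [_|s x IHs]; first exact: quadratic_tower_nil.
move=> /construction_rcons[/IHs tower_s step_x].
rewrite map_rcons; apply: quadratic_tower_rcons tower_s => K iota Ks.
have {}Ks y : y \in s -> exists a, iota a = y%:C%C by move=> ys; apply/Ks/map_f.
case: step_x => [->|[[y [z [/Ks[a Da] /Ks[b Db] Dx]]]|[y [/Ks[a Da] y_ge0 ->]]]].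
- by exists 1; rewrite !rmorph1 expr1n.
- suff [c ->] : exists c, x%:C%C = iota c by exists (c ^+ 2); rewrite rmorphXn.
  case: Dx => [->|->|->|[_ ->]].
  + by exists (a + b); rewrite !rmorphD /= Da Db.
  + by exists (a - b); rewrite !rmorphB /= Da Db.
  + by exists (a * b); rewrite !rmorphM /= Da Db.
  + by exists (a / b); rewrite !rmorphM !fmorphV /= Da Db.
- by exists a; rewrite Da -rmorphXn /= sqr_sqrtr.
Qed.

End RealConstructible.

(** * Roots of unity as values of cosine and sine *)

Section Trigonometry.
Variable R : realType.

Definition cis (t : R) : R[i] := (cos t +i* sin t)%C.

Lemma cisX (t : R) (n : nat) : cis t ^+ n = cis (n%:R * t).
Proof.
elim: n => [|n IHn]; first by rewrite mul0r /cis cos0 sin0 expr0.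
rewrite exprS IHn -natr1 mulrDl mul1r addrC /cis cosD sinD.
by apply/eqP; rewrite eq_complex /= eqxx [X in X == _]addrC eqxx.
Qed.

(** [cos t = 1 - 2 * sin (t / 2) ^+ 2], and [sin] is positive on [(0, pi)]. *)
Lemma cos_lt2pi_neq1 (t : R) : 0 < t -> t < 2 * pi -> cos t != 1.
Proof.
move=> t_gt0 t_lt; have sin_gt0 : 0 < sin (t / 2).
  by apply: sin_gt0_pi; rewrite divr_gt0 ?ltr0n //= ltr_pdivrMr // mulrC.
have -> : t = (t / 2) + (t / 2) by field.
rewrite cosD; have := cos2Dsin2 (t / 2).
move=> cs1; have sin2_gt0 := mulr_gt0 sin_gt0 sin_gt0.
by apply/eqP => cs2; rewrite !expr2 in cs1; lra.
Qed.

Lemma cis_prim_root (n : nat) : (0 < n)%N -> n.-primitive_root (cis (2 * pi / n%:R)).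
Proof.
move=> n_gt0; have n_neq0 : n%:R != 0 :> R by rewrite pnatr_eq0 -lt0n.
have cis_n : cis (2 * pi / n%:R) ^+ n = 1.
  by rewrite cisX mulrC divfK // /cis mulrC mulr_natr cos2pi sin2pi.
have [m prim_m m_dvd] := prim_order_exists n_gt0 cis_n.
have m_gt0 := prim_order_gt0 prim_m.
suff Dm : m = n by rewrite -{1}Dm.
apply/eqP; rewrite eqn_leq (dvdn_leq n_gt0 m_dvd) leqNgt; apply/negP => m_lt.
have := prim_expr_order prim_m; rewrite cisX => -[/eqP + _]; apply/negP.
apply: cos_lt2pi_neq1.
  by rewrite mulr_gt0 ?ltr0n // divr_gt0 ?ltr0n // mulr_gt0 // pi_gt0.
rewrite mulrA ltr_pdivrMr ?ltr0n // mulrC ltr_pM2l ?ltr_nat //.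
by rewrite mulr_gt0 // pi_gt0.
Qed.
End Trigonometry.

(** * The Gauss-Wantzel theorem *)

Theorem mainTheorem1 (R : realType) (n : nat) (hn : (0 < n)%N) :
  real_constructible (cos (2 * pi / n%:R) : R) <->
  exists (a : nat) (ps : seq nat),
    [/\ uniq ps,
        (forall p : nat, p \in ps ->
           prime p /\ exists s : nat, p = (2 ^ (2 ^ s) + 1)%N) &
        n = (2 ^ a * \prod_(p <- ps) p)%N].
Proof.
set t := 2 * pi / n%:R; have prim_z := cis_prim_root R n hn.
split=> [[s c_s]|[a [ps [uniq_ps fermat_ps Dn]]]].
  (* [i] and [sin t] are square roots of [-1] and [1 - cos t ^+ 2], and with them
     [z = cos t + i sin t] is in the tower. *)
  have tower_i : in_quadratic_tower R[i]
      (rcons (rcons [seq x%:C%C | x <- rcons s (cos t)] 'i%C) (sin t)%:C%C).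
    apply: quadratic_tower_rcons => [K iota Ks|]; last first.
      apply: quadratic_tower_rcons => [K iota Ks|]; last exact: construction_quadratic_tower.
      by exists (- 1); rewrite rmorphN1 sqr_i.
    have [|c Dc] := Ks (cos t)%:C%C.
      by rewrite mem_rcons inE map_f ?orbT // mem_rcons mem_head.
    exists (1 - c ^+ 2); rewrite rmorphB rmorphXn rmorph1 /= Dc -!rmorphXn /=.
    by rewrite sin2cos2 rmorphB rmorph1.
  have [K [iota [m [dim_K Ks]]]] := tower_i.
  have [c Dc] : exists c, iota c = (cos t)%:C%C.
    by apply: Ks; rewrite mem_rcons inE mem_rcons inE map_f ?orbT // mem_rcons mem_head.
  have [j Dj] : exists j, iota j = 'i%C by apply: Ks; rewrite mem_rcons inE mem_rcons mem_head orbT.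
  have [d Dd] : exists d, iota d = (sin t)%:C%C by apply: Ks; rewrite mem_rcons mem_head.
  apply: (@totient_dvd_expn2 n m hn); rewrite -dim_K; apply: (@totient_dvd_dim K n (c + j * d)).
  rewrite -(fmorph_primitive_root iota) rmorphD rmorphM /= Dc Dj Dd.
  by rewrite -(complexE (cis R t)); exact: prim_z.
have [//] : complex_constructible R (cis R t).
apply: (@qclosed_fermat_unity_roots R[i] (complex_constructible R)
  (complex_constructible1 R) (@complex_constructibleB R) (@complex_constructibleM R)
  (@complex_constructibleV R) (@complex_constructible_root2 R) a ps).
- by rewrite pnatr_eq0.
- by move=> m; exists (cis R (2 * pi / (2 ^ m)%N%:R)); apply: cis_prim_root; rewrite expn_gt0.
- exact: uniq_ps.
- by move=> p /fermat_ps[p_prime [s Dp]]; split=> //; exists (2 ^ s)%N.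
- by rewrite -Dn (prim_expr_order prim_z).
Qed.
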